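(* Let $1\to\Delta\to\Gamma\xrightarrow{\pi}\Lambda\to 1$ be an exact sequence of countable groups with $\Gamma$ residually finite. Let $(N_i)$ be a countable collection, directed by inclusion, of finite index normal subgroups of $\Gamma$ which separates $\Delta/(\bigcap_i(N_i\cap\Delta))$ from $\Gamma/(\bigcap_i N_i)$. Consider the induced collections $(N_i\cap\Delta)$ of finite index normal subgroups of $\Delta$ and $(N_i/(\Delta\cap N_i))$ of finite index normal subgroups of $\Lambda$ (here $N_i/(\Delta\cap N_i)$ is identified with $\pi(N_i)$), and the corresponding odometer actions. If $\mathrm{DAD}_{free}(\Delta\curvearrowright\widehat\Delta_{(N_i\cap\Delta)})=m$ and $\mathrm{DAD}_{free}(\Lambda\curvearrowright\widehat\Lambda_{(N_i/(\Delta\cap N_i))})=n$, then $\mathrm{DAD}_{free}(\Gamma\curvearrowright\widehat\Gamma_{(N_i)})\le m+n$.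
   Context: Profinite completion / odometer: for a countable group $\Gamma$ and a countable collection $(N_i)$ of finite index subgroups directed by inclusion, $\widehat\Gamma_{(N_i)}=\varprojlim_i\Gamma/N_i$ (left cosets), with the topology inherited from the product $\prod_i\Gamma/N_i$ of finite discrete spaces. $\Gamma$ acts on it by left multiplication in each coordinate. Separation: given a subgroup $\Delta<\Gamma$ and a countable directed collection $(N_i)$ of finite index normal subgroups of $\Gamma$, $(N_i)$ separates $\Delta$ from $\Gamma$ if for every $\gamma\in\Gamma\setminus\Delta$ there is $i$ with $\gamma N_i\notin\{\delta N_i\mid\delta\in\Delta\}$. Saying that $(N_i)$ separates $\Delta/(\bigcap_i(N_i\cap\Delta))$ from $\Gamma/(\bigcap_iN_i)$ means that the images of the $N_i$ in $\Gamma/(\bigcap_i N_i)$ separate the image of $\Delta$ (which is isomorphic to $\Delta/(\bigcap_i(N_i\cap\Delta))$) from $\Gamma/(\bigcap_i N_i)$. $\mathrm{DAD}_{free}(\Gamma\curvearrowright X)$, for an action by homeomorphisms on a compact space, is the smallest integer $d\ge 0$ such that for every finite $F\subset\Gamma$ there is an open cover $U_0,\dots,U_d$ of $X$ such that for all $0\le j\le d$ and $x\in U_j$, the set of $y\in X$ for which there exist $f_1,\dots,f_k\in F$ with $y=f_k\cdots f_1\cdot x$ and $f_{k_0}\cdots f_1\cdot x\in U_j$ for all $1\le k_0\le k$ is finite, with cardinality bounded independently of $x$ ($\infty$ if no such $d$ exists). *)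

(* Defs.v *)
From HB Require Import structures.
From mathcomp Require Import all_boot all_order all_algebra.
From mathcomp Require Import all_classical.
From mathcomp Require Import constructive_ereal topology.

Set Implicit Arguments.
Unset Strict Implicit.
Unset Printing Implicit Defensive.

Local Open Scope classical_set_scope.
Local Open Scope group_scope.

Section Subgroups.
Variable G : groupType.
Implicit Types (H K D : set G) (g h : G).

Definition normal_subgroup H :=
  group_closed [in H] /\ forall g h, H h -> H (g * h * g^-1).

Definition lcoset H g : set G := [set g * h | h in H].

Definition lcosets H : set (set G) := range (lcoset H).

Definition finite_index H := finite_set (lcosets H).

Definition residually_finite :=
  forall g, g <> 1 ->
    exists H, [/\ normal_subgroup H, finite_index H & ~ H g].

(* The order on indices is reverse inclusion, so directedness asks for lower
   bounds. *)
Definition directed_by_inclusion (I : Type) (N : I -> set G) :=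
  inhabited I /\ forall i j, exists k, N k `<=` N i `&` N j.

Definition separates (I : Type) (N : I -> set G) D :=
  forall g, ~ D g ->
    exists i, ~ [set lcoset (N i) d | d in D] (lcoset (N i) g).

Lemma normal_subgroup1 H : normal_subgroup H -> H 1.
Proof. by move=> [[/set_mem]]. Qed.

Lemma normal_subgroupF H g h : normal_subgroup H -> H g -> H h -> H (g * h^-1).
Proof. by move=> [[_ Hd] _] Hg Hh; apply/set_mem/Hd; apply/mem_set. Qed.

Lemma normal_subgroupV H h : normal_subgroup H -> H h -> H h^-1.
Proof.
by move=> nH Hh; rewrite -[h^-1]mul1g; apply: normal_subgroupF => //;
  apply: normal_subgroup1.
Qed.

Lemma normal_subgroupM H g h : normal_subgroup H -> H g -> H h -> H (g * h).
Proof.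
move=> nH Hg Hh; rewrite -[h]invgK; apply: normal_subgroupF => //.
exact: normal_subgroupV.
Qed.

Lemma normal_bigcap (I : Type) (N : I -> set G) :
  (forall i, normal_subgroup (N i)) -> normal_subgroup (\bigcap_i N i).
Proof.
move=> nN; split; last first.
  by move=> g h Nh i _; apply: (nN i).2; apply: Nh.
split; first by apply/mem_set => i _; apply: normal_subgroup1.
move=> g h /set_mem Ng /set_mem Nh; apply/mem_set => i _.
by apply: normal_subgroupF; [|apply: Ng|apply: Nh].
Qed.

End Subgroups.

Section Quotient.
Variables (G : groupType) (K : set G) (nK : normal_subgroup K).

Lemma mul_lcoset g h :
  [set x * y | x in lcoset K g & y in lcoset K h] = lcoset K (g * h).
Proof.
apply/seteqP; split=> [_ [_ [a Ka <-]] [_ [b Kb <-]] <-|_ [a Ka <-]].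
  exists (h^-1 * a * h^-1^-1 * b).
    by apply: normal_subgroupM => //; apply: nK.2.
  by rewrite invgK !mulgA mulgK.
exists g; first by exists 1; rewrite ?mulg1//; apply: normal_subgroup1.
by exists (h * a); [exists a|rewrite mulgA].
Qed.

Lemma inv_lcoset g : [set x^-1 | x in lcoset K g] = lcoset K g^-1.
Proof.
apply/seteqP; split=> [_ [_ [a Ka <-]] <-|_ [a Ka <-]].
  exists (g * a^-1 * g^-1); first by apply: nK.2; apply: normal_subgroupV.
  by rewrite invgM !mulgA mulVg mul1g.
exists (g * (g^-1 * a^-1 * g)); last by rewrite !mulgA mulgV mul1g invgM invgK.
exists (g^-1 * a^-1 * g) => //; rewrite -[X in _ * X]invgK.
by apply: nK.2; apply: normal_subgroupV.
Qed.

Definition quotient of normal_subgroup K : Type := lcosets K.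
Local Notation Q := (quotient nK).

Definition quo (g : G) : Q := SigSub (mem_set (imageT (lcoset K) g)).

Definition quo_mul (a b : Q) : Q.
Proof.
exists [set x * y | x in val a & y in val b].
case: a b => [a /set_mem[g _ ga]] [b /set_mem[h _ hb]] /=.
by rewrite -ga -hb mul_lcoset; apply/mem_set; apply: imageT.
Defined.

Definition quo_inv (a : Q) : Q.
Proof.
exists [set x^-1 | x in val a].
case: a => [a /set_mem[g _ ga]] /=.
by rewrite -ga inv_lcoset; apply/mem_set; apply: imageT.
Defined.

Lemma quo_surj a : exists g, a = quo g.
Proof.
have /set_mem[g _ ga] := valP a.
by exists g; apply: val_inj; rewrite /= ga.
Qed.

Lemma quoM g h : quo (g * h) = quo_mul (quo g) (quo h).
Proof. by apply: val_inj; rewrite /= mul_lcoset. Qed.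

Lemma quoV g : quo g^-1 = quo_inv (quo g).
Proof. by apply: val_inj; rewrite /= inv_lcoset. Qed.

Let quo_mulA : associative quo_mul.
Proof.
move=> a b c; have [x ->] := quo_surj a; have [y ->] := quo_surj b.
by have [z ->] := quo_surj c; rewrite -!quoM mulgA.
Qed.

Let quo_mul1 : left_id (quo 1) quo_mul.
Proof. by move=> a; have [x ->] := quo_surj a; rewrite -quoM mul1g. Qed.

Let quo_1mul : right_id (quo 1) quo_mul.
Proof. by move=> a; have [x ->] := quo_surj a; rewrite -quoM mulg1. Qed.

Let quo_mulV : left_inverse (quo 1) quo_inv quo_mul.
Proof. by move=> a; have [x ->] := quo_surj a; rewrite -quoV -quoM mulVg. Qed.

Let quo_Vmul : right_inverse (quo 1) quo_inv quo_mul.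
Proof. by move=> a; have [x ->] := quo_surj a; rewrite -quoV -quoM mulgV. Qed.

HB.instance Definition _ := Choice.copy Q (lcosets K).
HB.instance Definition _ :=
  isGroup.Build Q quo_mulA quo_mul1 quo_1mul quo_mulV quo_Vmul.
HB.instance Definition _ := isMultiplicative.Build G Q quo quoM.

End Quotient.

Section Odometer.
Variables (G : groupType) (I : Type) (N : I -> set G).

(* The transition map G / N i -> G / N j sends gN_i to gN_j. *)
Definition compatible
    (x : prod_topology (fun i => discrete_topology (lcosets (N i)))) :=
  forall i j, N i `<=` N j ->
    exists g, val (x i) = lcoset (N i) g /\ val (x j) = lcoset (N j) g.

Definition profinite_completion : topologicalType :=
  [set x | compatible x] : Type.

Lemma lcosetM (H : set G) g h :
  [set g * y | y in lcoset H h] = lcoset H (g * h).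
Proof.
rewrite /lcoset image_comp; apply: eq_imagel => y _ /=; exact: mulgA.
Qed.

Definition lcoset_act (H : set G) (g : G) (a : lcosets H) : lcosets H.
Proof.
exists [set g * y | y in val a].
case: a => [a /set_mem[h _ ha]] /=.
by rewrite -ha lcosetM; apply/mem_set; apply: imageT.
Defined.

Definition odometer (g : G) (x : profinite_completion) : profinite_completion.
Proof.
exists (fun i => lcoset_act g (val x i)).
case: x => [x /set_mem /= cx]; apply/mem_set => /= i j /cx[h [xi xj]].
by exists (g * h); rewrite /= xi xj !lcosetM.
Defined.

Lemma odometer1 : odometer 1 =1 id.
Proof.
move=> x; apply: val_inj => /=; apply: functional_extensionality_dep => i.
by apply: val_inj => /=; under eq_imagel do rewrite mul1g; rewrite image_id.
Qed.

Lemma odometerM g h : odometer (g * h) =1 odometer g \o odometer h.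
Proof.
move=> x; apply: val_inj => /=; apply: functional_extensionality_dep => i.
apply: val_inj => /=; rewrite image_comp.
by apply: eq_imagel => y _ /=; rewrite mulgA.
Qed.

Lemma completion_coord_continuous i :
  continuous (fun x : profinite_completion =>
    val x i : discrete_topology (lcosets (N i))).
Proof.
pose T i := discrete_topology (lcosets (N i)).
move=> x; have cx : set_val @ nbhs x --> (val x : prod_topology T).
  exact: initial_continuous.
move=> U nU; have [+ _] := cvg_sup
  (fun i => Topological.class
    (initial_topology (fun f : (forall i, T i) => f i))) (val x) (fmap_filter set_val (nbhs_filter x)).
move=> /(_ cx i) cf.
apply: (cf ((fun f => f i) @^-1` U)).
by apply: (@initial_continuous _ _ (fun f : forall i, T i => f i)).
Qed.

Lemma odometer_continuous g : continuous (odometer g).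
Proof.
apply: continuous_comp_initial => x.
have [_] := cvg_sup
  (fun i => Topological.class (initial_topology (fun f : (forall i,
    discrete_topology (lcosets (N i))) => f i)))
  (val (odometer g x)) (fmap_filter (set_val \o odometer g) (nbhs_filter x)).
apply=> i U [_ /= [[V _ <-]]] /= Vx VU; rewrite nbhs_simpl.
have : nbhs x [set y : profinite_completion | val y i = val x i].
  exact: completion_coord_continuous (discrete_set1 _).
by apply: filterS => y /= yx; apply: VU; rewrite /= set_valE /= yx.
Qed.

Lemma profinite_completion_compact :
  (forall i, finite_index (N i)) -> compact [set: profinite_completion].
Proof.
move=> fN; rewrite compact_ultra => F UF _.
have Fa i : exists a : lcosets (N i), F [set y | val y i = a].
  have FN : F [set y | lcosets (N i) (val (val y i))].
    by apply: filterS filterT => y _ /=; case: (val y i) => c Nc; apply: set_mem Nc.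
  have /(_ ((fun y : profinite_completion => val (val y i)) @ F)) :=
    @finite_compact (discrete_topology (set G)) _ (fN i).
  move=> /(_ _ FN)[a [/mem_set Na Fa]].
  exists (SigSub Na).
  have [//|Fc] := in_ultra_setVsetC [set y | val y i = SigSub Na] UF.
  have Fca : F [set y | val (val y i) <> a].
    by apply: (filterS _ Fc) => y yn ya; apply: yn; apply: val_inj.
  by have [_ [/[apply]]] := Fa [set~ a] [set a] Fca (discrete_set1 _).
pose a i := projT1 (cid (Fa i)).
have aP i : F [set y | val y i = a i] := projT2 (cid (Fa i)).
have ca : a \in [set a | compatible a].
  apply/mem_set => i j Nij.
  have [y [/= <- <-]] := filter_ex (filterI (aP i) (aP j)).
  by case: y => [y cy]; apply: (set_mem cy).
exists (SigSub ca); split=> //= U [_ /= [[V oV <-]]] /= Va VU.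
apply: (filterS VU).
have [_] := cvg_sup
  (fun i => Topological.class (initial_topology (fun f : (forall i,
    discrete_topology (lcosets (N i))) => f i)))
  a (fmap_filter set_val (@ultra_proper _ _ UF)).
move=> H.
suff : val @ F --> (a : prod_topology (fun i => discrete_topology (lcosets (N i)))).
  by apply; exact: open_nbhs_nbhs.
apply: H => i W [_ /= [[V' _ <-]]] /= V'a V'W.
change (F [set y | W (val y)]).
have : F [set y | val y i = a i] := aP i.
by apply: filterS => y /= ya; apply: V'W; rewrite /= ya.
Qed.

End Odometer.

Arguments profinite_completion {G I} N.
Arguments odometer {G I} N g x.

Section DAD.
Variables (G : groupType) (X : topologicalType) (act : G -> X -> X).

(* foldl act applied to [:: f_1; ...; f_k] computes f_k ... f_1 x; taking k = 0
   adds only the point x itself. *)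
Definition act_seq (x : X) (f : seq G) : X := foldl (fun y g => act g y) x f.

Definition partial_orbit (F : set G) (U : set X) (x : X) : set X :=
  [set y | exists f : seq G,
    [/\ forall g, g \in f -> F g, y = act_seq x f &
        forall k, (1 <= k <= size f)%N -> U (act_seq x (take k f))]].

Definition has_dad_cover (d : nat) :=
  forall F : set G, finite_set F ->
    exists U : 'I_d.+1 -> set X,
      [/\ forall j, open (U j), \bigcup_j U j = setT &
          forall j, exists B : nat, forall x, U j x ->
            (partial_orbit F (U j) x #<= `I_B)%card].

(* \bar int only supplies the order and the addition of {0, 1, ..., +oo}. *)
Definition dad_free : \bar int :=
  match pselect (exists d, `[< has_dad_cover d >]) with
  | left h => (Posz (ex_minn h))%:E
  | right _ => +oo%E
  end.

End DAD.

(* Main.v *)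
Require Import Defs.
From mathcomp Require Import all_boot all_order all_algebra.
From mathcomp Require Import all_classical.
From mathcomp Require Import constructive_ereal topology.

(* The multiplicity of the cover of [Gamma] is controlled by Kolmogorov's trick:
   enlarging the members of a cover whose paths are bounded and adding the set of
   points covered exactly [c] times gives one more set and one more layer.  So
   [Delta] has a cover by [m + n + 1] sets with every point in at least [n + 1] of
   them, and [Lambda] one by [m + n + 1] sets [A j] with every point in at least
   [m + 1] of them; pairing sets of equal index still covers [Gamma], since
   [(m + 1) + (n + 1) > m + n + 1].

   The covers of the fibres have to be chosen fibre by fibre.  Separation provides
   a level [i] at which a path over [A j] that returns to its coset of [Delta N_i]
   returns to its coset of [Delta K], where [K] is the intersection of the [N_i].
   Order the finitely many cosets of [Delta N_i] and choose the covers of the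
   fibres one coset after the other: the paths between two visits to the current
   coset only meet earlier cosets, so they are already bounded, and the cover of
   the current fibre is chosen for the finite set of the resulting displacements. *)

Set Implicit Arguments.
Unset Strict Implicit.
Unset Printing Implicit Defensive.

Local Open Scope classical_set_scope.
Local Open Scope group_scope.

Ltac grp_simp := rewrite
  ?(invgM, invgK, invg1, mulgA, mulgK, mulgVK, mulVg, mulgV, mul1g, mulg1).

Section Morphism.
Variables (G H : groupType) (f : {multiplicative G -> H}).

Lemma multiplicative1 : f 1 = 1.
Proof. by apply: (mulgI (f 1)); rewrite -gmulfM !mulg1. Qed.

Lemma multiplicativeV g : f g^-1 = (f g)^-1.
Proof. by apply/divg1_eq; rewrite invgK -gmulfM mulVg multiplicative1. Qed.

End Morphism.

(** * Paths and cosets *)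

Section Reach.
Variable G : groupType.
Implicit Types (A B F K S U : set G) (a b f g h : G).

Definition prodset A B : set G := [set a * b | a in A & b in B].

Lemma prodset_mem A B a b : A a -> B b -> prodset A B (a * b).
Proof. by move=> Aa Bb; exists a => //; exists b. Qed.

Lemma finite_prodset A B :
  finite_set A -> finite_set B -> finite_set (prodset A B).
Proof. exact: finite_image2. Qed.

(* [reach F U g a]: the point [a * g] is reached from [g] by left
   multiplications by elements of [F], staying in [U] after each of them. *)
Inductive reach F U g : G -> Prop :=
| reach1 : reach F U g 1
| reachS a f : reach F U g a -> F f -> U (f * a * g) -> reach F U g (f * a).

Lemma reach_sub F F' U U' g a : F `<=` F' -> U `<=` U' ->
  reach F U g a -> reach F' U' g a.
Proof.
move=> FF UU; elim=> [|b f _ IH /FF Ff /UU Uf]; first exact: reach1.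
exact: reachS.
Qed.

Lemma reach_end F U g a : U g -> reach F U g a -> U (a * g).
Proof. by move=> Ug; case=> [|b f _ _ //]; rewrite mul1g. Qed.

Lemma reach_trans F U g a b :
  reach F U g a -> reach F U (a * g) b -> reach F U g (b * a).
Proof.
move=> ra; elim=> [|c f _ IH Ff Uf]; first by rewrite mul1g.
by rewrite -mulgA; apply: reachS => //; move: Uf; rewrite !mulgA.
Qed.

Lemma reach_step F U g f : F f -> U (f * g) -> reach F U g f.
Proof.
by move=> Ff Uf; rewrite -[f]mulg1; apply: reachS; rewrite ?mulg1//; exact: reach1.
Qed.

End Reach.

Section NormalSubgroup.
Variables (G : groupType) (K : set G).
Hypothesis nK : normal_subgroup K.
Implicit Types (A B S : set G) (a b g h : G).

Lemma normal_conj g h : K h -> K (g * h * g^-1).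
Proof. exact: nK.2. Qed.

Lemma normal_conjV g h : K h -> K (g^-1 * h * g).
Proof. by move/(normal_conj (g^-1)); rewrite invgK. Qed.

Lemma lcosetP g h : lcoset K g h <-> K (g^-1 * h).
Proof.
split=> [[k Kk <-]|Kh]; first by grp_simp.
by exists (g^-1 * h) => //; grp_simp.
Qed.

Lemma lcoset_eqP g h : lcoset K g = lcoset K h <-> K (g^-1 * h).
Proof.
split=> [e|Kgh]; first
  by apply/lcosetP; rewrite e; apply/lcosetP; grp_simp; apply: normal_subgroup1.
apply/seteqP; split=> x /lcosetP Kx; apply/lcosetP.
  have := normal_subgroupM nK (normal_subgroupV nK Kgh) Kx.
  by grp_simp.
have := normal_subgroupM nK Kgh Kx.
by grp_simp.
Qed.

(** This is the product [S K]; for finite [S], membership bounds a displacement modulo [K]. *)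
Definition coset_in S : set G := [set g | exists2 s, S s & K (s^-1 * g)].

Lemma coset_in_mem S g : S g -> coset_in S g.
Proof. by move=> Sg; exists g => //; rewrite mulVg; apply: normal_subgroup1. Qed.

Lemma coset_in_sub S S' : S `<=` S' -> coset_in S `<=` coset_in S'.
Proof. by move=> SS g [s /SS Ss Ks]; exists s. Qed.

Lemma coset_in_mul S S' g h :
  coset_in S g -> coset_in S' h -> coset_in (prodset S S') (g * h).
Proof.
move=> [s Ss Ks] [t St Kt]; exists (s * t); first exact: prodset_mem.
have := normal_subgroupM nK (normal_conjV t Ks) Kt.
by grp_simp; congr (K _); grp_simp.
Qed.

End NormalSubgroup.

(** * Covers of higher multiplicity *)

Section Multicover.
Variables (G : groupType) (I : Type) (N : I -> set G).
Implicit Types (F S : set G) (U : nat -> set G) (a b f g h : G).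

Definition cover_index U k g : {set 'I_k} := finset (fun j : 'I_k => `[< U j g >]).

Lemma cover_indexP U k g (j : 'I_k) : reflect (U j g) (j \in cover_index U k g).
Proof. by rewrite inE; apply: asboolP. Qed.

Lemma card_cover_indexS U k g :
  #|cover_index U k.+1 g| = (#|cover_index U k g| + `[< U k g >])%N.
Proof.
rewrite /cover_index !cardsE -!sum1_card big_mkcond big_ord_recr /=.
by rewrite -big_mkcond unfold_in; case: asbool.
Qed.

Definition right_invariant i (U : set G) := forall g h, N i h -> U g -> U (g * h).

(* A cover of the odometer can be read off a finite level [G / N i], as a family of
   right [N i]-invariant subsets of [G].  The bound on paths is modulo the
   intersection of the [N i] because this is what acts trivially.  For [c = 1] this
   is [has_dad_cover] with [k] sets. *)
Definition multicover k c := forall F, finite_set F ->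
  exists i U S, [/\ finite_set S, forall j, right_invariant i (U j),
    forall g, (c <= #|cover_index U k g|)%N &
    forall j, (j < k)%N -> forall g a, U j g -> reach F (U j) g a ->
      coset_in (\bigcap_i N i) S a].

Hypothesis nN : forall i, normal_subgroup (N i).
Let nK := normal_bigcap nN.

(** At a point of [Z] the enlargement [U1] adds no index, because [U] already has [c] of them. Hence
    an [F]-step inside [Z] keeps the set of indices, and a path in [Z] is a path in any one [U j0]
    containing its start. A path in [U1 j] is shadowed by one in [U j]. *)
Lemma multicoverS k c : (0 < c)%N -> multicover k c -> multicover k.+1 c.+1.
Proof.
move=> c0 mc F fF.
pose F1 := F `|` [set 1].
have F1_1 : F1 1 by right.
have fF1 : finite_set F1 by rewrite finite_setU.
pose F1V := [set f^-1 | f in F1].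
have fF1V : finite_set F1V by exact: finite_image.
(* [F'] is [F1 F F1^-1], which contains the steps of the shadowing paths. *)
pose F' := prodset F1 (prodset F F1V).
have fF' : finite_set F' by do 2 apply: finite_prodset => //.
have FF' : F `<=` F'.
  move=> f Ff; rewrite -[f]mul1g -[f]mulg1; apply: prodset_mem => //.
  by apply: prodset_mem => //; exists 1; rewrite ?invg1.
have [i [U [S [fS Ui Uc US]]]] := mc _ fF'.
pose U1 j := [set g | exists2 f, F1 f & U j (f * g)].
pose Z := [set g | #|cover_index U1 k g| = c].
have U1i j : right_invariant i (U1 j).
  by move=> g h Nh [f Ff Ufg]; exists f; rewrite // mulgA; apply: Ui.
have UU1 j : U j `<=` U1 j by move=> g Ug; exists 1; rewrite ?mul1g.
have idx_sub g : cover_index U k g \subset cover_index U1 k g.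
  by apply/fintype.subsetP => j /cover_indexP/UU1 /cover_indexP.
have Z_idx g : Z g -> cover_index U k g = cover_index U1 k g.
  by move=> Zg; apply/eqP; rewrite eqEcard idx_sub Zg Uc.
have Z_step g f : F f -> Z g -> Z (f * g) ->
    cover_index U k (f * g) = cover_index U k g.
  move=> Ff Zg Zfg; apply/eqP; rewrite eqEcard (Z_idx g)// Zg Uc andbT.
  apply/fintype.subsetP => j /cover_indexP Ujfg; apply/cover_indexP.
  by exists f => //; left.
exists i, (fun j => if (j < k)%N then U1 j else Z).
exists (prodset (prodset F1V S) F1 `|` S); split.
- by rewrite finite_setU; split=> //; do 2 apply: finite_prodset => //.
- move=> j; case: ifP => // _ g h Nh; rewrite /Z /= => <-; congr #|pred_of_set _|.
  apply/setP => x; apply/cover_indexP/cover_indexP; last exact: U1i.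
  rewrite -{2}[g](mulgK h); apply: U1i; exact: normal_subgroupV.
- move=> g; rewrite card_cover_indexS ltnn.
  have -> : cover_index (fun j => if (j < k)%N then U1 j else Z) k g = cover_index U1 k g.
    by apply/setP => j; rewrite !inE ltn_ord.
  (* Either [g] lies in exactly [c] enlarged sets, hence in [Z], or it already lies in more. *)
  have := leq_trans (Uc g) (subset_leq_card (idx_sub g)).
  rewrite leq_eqVlt => /orP[/eqP e|lt]; last by rewrite (leq_trans lt)// leq_addr.
  by rewrite -e asboolT ?addn1.
- move=> j jk g a; case: ifP => [{}jk [f Ff Ufg] ra|_ Zg ra].
    (* Every point of the path has an [F1]-translate in [U j]; consecutive translates differ by a
       step in [F']. *)
    have [f' F1f' [Uf' rf']] : exists2 f', F1 f' & U j (f' * a * g) /\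
        reach F' (U j) (f * g) (f' * a * f^-1).
      elim: ra => [|b e _ [f1 Ff1 [Uf1 rf1]] Fe [f2 Ff2 Uf2]].
        by exists f => //; split; grp_simp => //; apply: reach1.
      exists f2 => //; rewrite !mulgA in Uf2 *; split=> //.
      have -> : f2 * e * b * f^-1 = (f2 * (e * f1^-1)) * (f1 * b * f^-1) by grp_simp.
      apply: reachS => //; last by grp_simp.
      by apply: prodset_mem => //; apply: prodset_mem => //; exists f1.
    have := US _ jk _ _ Ufg rf'.
    move=> /(coset_in_mul nK (coset_in_mem nK (S := F1V) (g := f'^-1) _)).
    move=> /(_ (imageP _ F1f')) /coset_in_mul - /(_ nK F1 f) /(_ (coset_in_mem nK Ff)).
    by grp_simp; apply: coset_in_sub => x; left.
  have [j0 Uj0] : exists j0, j0 \in cover_index U k g.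
    by apply/set0Pn; rewrite -card_gt0 (leq_trans c0).
  suff [_ _ ra0] : [/\ Z (a * g), cover_index U k (a * g) = cover_index U k g &
      reach F' (U j0) g a].
    apply: (coset_in_sub (S := S)); first by move=> x; right.
    by apply: US ra0 => //; apply/cover_indexP.
  elim: ra => [|b f _ [Zb eb rb] Ff Zf]; first by rewrite mul1g; split=> //; exact: reach1.
  have ef : cover_index U k (f * b * g) = cover_index U k g.
    by rewrite -mulgA Z_step// mulgA.
  split=> //; apply: reachS => //; first exact: FF'.
  by apply/cover_indexP; rewrite ef.
Qed.

Lemma multicoverD k c e : (0 < c)%N -> multicover k c -> multicover (k + e) (c + e).
Proof.
move=> c0 mc; elim: e => [|e IH]; first by rewrite !addn0.
by rewrite !addnS; apply: multicoverS => //; rewrite addn_gt0 c0.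
Qed.

End Multicover.

(** * Covers of an extension *)

Section FirstReturn.
Variables (G : groupType) (K : set G).
Hypothesis nK : normal_subgroup K.
Implicit Types (F S X Y Z : set G) (a b f g h w y : G).

(** Displacements between consecutive visits to [Y]: one step, or a step out, a stretch bounded by
    [S] and a step back. *)
Definition return_words F S := F `|` prodset F (prodset S F).

(** The second clause remembers a path in [X] realising the displacement, as separation speaks only
    of such paths. *)
Definition return_moves F S X Y : set G := [set w |
  coset_in K (return_words F S) w /\ exists y, [/\ Y y, Y (w * y) & reach F X y w]].

Definition return_bound F S S1 :=
  S `|` prodset ([set 1] `|` prodset S F) (prodset S1 ([set 1] `|` prodset F S)).

Lemma finite_return_words F S :
  finite_set F -> finite_set S -> finite_set (return_words F S).
Proof.
by move=> fF fS; rewrite finite_setU; split=> //; do 2 apply: finite_prodset => //.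
Qed.

Lemma finite_return_bound F S S1 :
  finite_set F -> finite_set S -> finite_set S1 -> finite_set (return_bound F S S1).
Proof.
move=> fF fS fS1; rewrite finite_setU; split=> //.
apply: finite_prodset; first by rewrite finite_setU; split=> //; exact: finite_prodset.
apply: finite_prodset => //.
by rewrite finite_setU; split=> //; exact: finite_prodset.
Qed.

(* Cut a path in [Y `|` Z] at its visits to [Y]: the first stretch is a path
   in [Z], then come returns to [Y], then a last stretch in [Z]. *)
Lemma first_return F S S1 X Y Z :
    Y `<=` X -> Z `<=` X -> X `<=` Y `|` Z ->
    (forall g a, Z g -> reach F Z g a -> coset_in K S a) ->
    (forall y a, Y y -> reach (return_moves F S X Y) Y y a -> coset_in K S1 a) ->
  forall g a, X g -> reach F X g a -> coset_in K (return_bound F S S1) a.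
Proof.
move=> YX ZX XYZ ZS YS1 g a Xg ra.
(* The part of a path after its latest visit [y] to [Y]. *)
pose stretch y b := b = 1 \/ exists b' f,
  [/\ b = b' * f, F f, Z (f * y) & reach F Z (f * y) b'].
have stretchX y b : stretch y b -> reach F X y b.
  move=> [->|[b' [f [-> Ff Zf rb]]]]; first exact: reach1.
  apply: reach_trans; first exact: reach_step Ff (ZX _ Zf).
  by apply: reach_sub rb.
have stretchS y b : stretch y b -> coset_in K ([set 1] `|` prodset S F) b.
  move=> [->|[b' [f [-> Ff Zf rb]]]]; first by apply: coset_in_mem => //; left.
  apply: (coset_in_sub (S := prodset S F)); first by move=> x; right.
  by apply: coset_in_mul => //; [exact: ZS rb|exact: coset_in_mem].
(* Either [Y] has not been met, or [a0] leads to the first visit, [a1] runs through the returns and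
   [b] is the current stretch. *)
have [[Zg rZ]|[b [a1 [a0 [-> Y0 sb [r1 a0S]]]]]] :
    (Z g /\ reach F Z g a) \/ exists b a1 a0,
    [/\ a = b * (a1 * a0), Y (a0 * g), stretch (a1 * (a0 * g)) b &
    reach (return_moves F S X Y) Y (a0 * g) a1 /\
      coset_in K ([set 1] `|` prodset F S) a0].
- elim: ra => [|c f _ IH Ff Xf].
    have [Yg|Zg] := XYZ _ Xg; last by left; split=> //; exact: reach1.
    right; exists 1, 1, 1; rewrite !mul1g; split=> //; first by left.
    by split; [exact: reach1|apply: coset_in_mem => //; left].
  move: Xf; case: IH => [[Zg rc]|[b [a1 [a0 [-> Y0 sb [r1 a0S]]]]]] Xf.
    have [Yf|Zf] := XYZ _ Xf; last by left; split=> //; exact: reachS.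
    right; exists 1, 1, (f * c); rewrite !mul1g; split=> //; first by left.
    split; first exact: reach1.
    apply: (coset_in_sub (S := prodset F S)); first by move=> x; right.
    by apply: coset_in_mul => //; [exact: coset_in_mem|exact: ZS rc].
  right; have Y1 := reach_end Y0 r1.
  have [Yf|Zf] := XYZ _ Xf.
    (* A new visit to [Y] closes the stretch: [f * b] becomes one return move. *)
    exists 1, (f * b * a1), a0; rewrite !mulgA mul1g; split=> //; first by left.
    split=> //; apply: reachS => //; last by move: Yf; rewrite !mulgA.
    split; last first.
      exists (a1 * (a0 * g)); split=> //; first by move: Yf; rewrite !mulgA.
      apply: reachS => //; first exact: stretchX.
      by apply: YX; move: Yf; rewrite !mulgA.
    case: sb => [->|[b' [f' [-> Ff' Zf' rb]]]].
      by rewrite mulg1; apply: coset_in_mem => //; left.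
    apply: (coset_in_sub (S := prodset F (prodset S F))); first by move=> x; right.
    apply: coset_in_mul => //; first exact: coset_in_mem.
    by apply: coset_in_mul => //; [exact: ZS rb|exact: coset_in_mem].
  exists (f * b), a1, a0; split=> //; first by rewrite !mulgA.
  right; case: sb => [eb|[b' [f' [eb Ff' Zf' rb]]]]; rewrite eb in Zf *.
    exists 1, f; rewrite mulg1 mul1g; split=> //; last exact: reach1.
    by move: Zf; rewrite !mulgA mulg1.
  exists (f * b'), f'; rewrite !mulgA in Zf *; split=> //.
    by move: Zf'; rewrite !mulgA.
  by apply: reachS; rewrite ?mulgA// in rb *.
- by apply: (coset_in_sub (S := S)); [move=> x; left|exact: ZS rZ].
apply: (coset_in_sub (S := prodset ([set 1] `|` prodset S F)
  (prodset S1 ([set 1] `|` prodset F S)))); first by move=> x; right.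
apply: coset_in_mul => //; first exact: stretchS sb.
by apply: coset_in_mul => //; exact: YS1 r1.
Qed.

End FirstReturn.

(** * Covers chosen fibre by fibre *)

Section Fibres.
Variables (Delta Gamma Lambda : groupType).
Variables
  (iota : {multiplicative Delta -> Gamma}) (pi : {multiplicative Gamma -> Lambda}).
Variables (I : Type) (N : I -> set Gamma).
Hypothesis nN : forall i, normal_subgroup (N i).
Hypothesis N_directed : directed_by_inclusion N.
Let K := \bigcap_i N i.
Let nK : normal_subgroup K := normal_bigcap nN.

Variables (F : set Gamma) (k c : nat) (A : nat -> set Lambda) (lab : Gamma -> nat).
Hypothesis fF : finite_set F.
Hypothesis mc : multicover (fun i => iota @^-1` N i) k c.
Hypothesis lab_return : forall j, (j < k)%N -> forall g a, A j (pi g) ->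
  reach (pi @` F) (A j) (pi g) (pi a) -> lab (a * g) = lab g ->
  exists d, K ((iota d)^-1 * a).

Lemma reach_morph F' (U : set Gamma) (V : set Lambda) g a :
  U `<=` pi @^-1` V -> reach F' U g a -> reach (pi @` F') V (pi g) (pi a).
Proof.
move=> UV; elim=> [|b f _ IH Ff Uf]; first by rewrite multiplicative1; exact: reach1.
rewrite gmulfM; apply: reachS => //.
by rewrite -!gmulfM; exact: UV Uf.
Qed.

(* On a coset of [iota Delta * N i] with representative [r], the function
   [ch] reads off [d] modulo [N i] from a point [iota d * r * n], [n] in [N i]. *)
Definition chart i (ch : Gamma -> Delta) := forall d g n, N i n ->
  N i (iota ((d * ch g)^-1 * ch (iota d * g * n))).

(** The fibres with label [l' < l] carry the covers [E l'] of [Delta], transported by [ch]. *)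
Definition piece (E : nat -> nat -> set Delta) ch l j : set Gamma :=
  [set g | [/\ (lab g < l)%N, A j (pi g) & E (lab g) j (ch g)]].

Lemma right_invariantE (i : I) (U : set Delta) d e :
  right_invariant (fun i => iota @^-1` N i) i U -> N i (iota (d^-1 * e)) ->
  U d <-> U e.
Proof.
move=> Ui Nde; split=> [Ud|Ue]; first by rewrite -[e](mulVKg d); exact: Ui Ud.
rewrite -[d](mulVKg e); apply: Ui Ue => /=.
by rewrite -[_ * _]invgK invgM invgK multiplicativeV; exact: normal_subgroupV.
Qed.

(** Induction on the number of fibres treated. The level deepens at each stage, so the bound is
    stated for every chart at any deeper level. *)
Lemma fibrewise_cover l : exists i E S, [/\ finite_set S,
  forall l' j, right_invariant (fun i => iota @^-1` N i) i (E l' j),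
  forall l', (l' < l)%N -> forall d, (c <= #|cover_index (E l') k d|)%N &
  forall i' ch, N i' `<=` N i -> chart i' ch -> forall j, (j < k)%N -> forall g a,
    piece E ch l j g -> reach F (piece E ch l j) g a -> coset_in K S a].
Proof.
elim: l => [|l [i [E [S [fS Ei Ec ES]]]]].
  have [[i] _] := N_directed.
  exists i, (fun _ _ => setT), set0; split=> //.
  by move=> i' ch _ _ j _ g a [].
(* [dl w] represents [w] modulo [K] in [Delta], with default value [1]. *)
pose dl w := xget 1 [set d | K ((iota d)^-1 * w)].
have fR := finite_return_words fF fS.
(* The new fibre is covered with respect to its possible returns, which depend on the bound [S] for
   earlier fibres. *)
have [i1 [E0 [S1 [fS1 E0i E0c E0S]]]] := mc (finite_image dl fR).
have [_ /(_ i i1)[i2 Ni2]] := N_directed.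
pose E' l' := if l' == l then E0 else E l'.
exists i2, E', (return_bound F S (iota @` S1)); split.
- by apply: finite_return_bound => //; exact: finite_image.
- move=> l' j d h /Ni2[Nih Ni1h]; rewrite /E'; case: eqP => _; first exact: E0i.
  exact: Ei.
- move=> l'; rewrite /E' ltnS leq_eqVlt; case: eqP => //= _; exact: Ec.
move=> i' ch Ni' chi j jk.
(* In the chart, [iota d] acts as left multiplication by [d], up to [N i'], which [E0 j] does not
   see. *)
have chE0 d g n : N i' n -> E0 j (ch (iota d * g * n)) <-> E0 j (d * ch g).
  move=> Nn; apply: iff_sym; apply: (right_invariantE (E0i j)).
  by have /Ni'/Ni2[] := chi d g n Nn.
pose Y := [set g | [/\ lab g = l, A j (pi g) & E0 j (ch g)]].
pose Z := piece E ch l j.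
have YX : Y `<=` piece E' ch l.+1 j.
  by move=> g [labg Ag Eg]; split; rewrite ?labg /E' ?eqxx.
have ZX : Z `<=` piece E' ch l.+1 j.
  move=> g [labg Ag Eg]; split=> //; first exact: ltnW.
  by rewrite /E' ltn_eqF.
have XYZ : piece E' ch l.+1 j `<=` Y `|` Z.
  move=> g [labg Ag]; rewrite /E'; case: eqP => [e|ne] Eg; first by left.
  by right; split=> //; rewrite ltn_neqAle -ltnS labg andbT; apply/eqP.
apply: (first_return nK YX ZX XYZ) => [|y a Yy rya].
  by apply: (ES i') => // x /Ni' /Ni2[].
have [d Kd rd] : exists2 d, K ((iota d)^-1 * a) &
    reach (dl @` return_words F S) (E0 j) (ch y) d.
  elim: rya => [|b w _ [d Kd rd] [[s Rs Ks] [z [Yz Ywz rz]]] Ywb].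
    exists 1; last exact: reach1.
    by rewrite multiplicative1 invg1 mulg1; exact: normal_subgroup1.
  have [e Ke] : exists e, K ((iota e)^-1 * w).
    apply: (lab_return jk (g := z)); [by case: Yz| |].
      by apply: reach_morph rz => x [].
    by case: Yz Ywz => -> _ _ [->].
  (* The step used is [dl s] and not [e], since it must lie in the finite set for which [E0] was
     chosen; [e] shows that a representative exists. *)
  have Kds : K ((iota (dl s))^-1 * s).
    rewrite /dl; case: xgetP => [x -> //|/(_ e)[]] /=.
    have := normal_subgroupM nK Ke (normal_subgroupV nK Ks).
    by grp_simp.
  have Kdw : K ((iota (dl s))^-1 * w).
    have := normal_subgroupM nK Kds Ks.
    by grp_simp.
  have Kdsd : K ((iota (dl s * d))^-1 * (w * b)).
    have := normal_subgroupM nK (normal_conjV nK (iota d) Kdw) Kd.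
    by rewrite gmulfM; grp_simp.
  exists (dl s * d) => //; apply: reachS => //.
  (* Conjugation by [y] moves the error in [K] to the right of [y], where the chart ignores it. *)
  case: Ywb => _ _; have -> : w * b * y =
      iota (dl s * d) * y * (y^-1 * ((iota (dl s * d))^-1 * (w * b)) * y) by grp_simp.
  by rewrite chE0 ?mulgA//; have := normal_conjV nK y Kdsd i' Logic.I; rewrite !mulgA.
have [_ _ E0y] := Yy; have [s S1s Ks] := E0S _ jk _ _ E0y rd.
exists (iota s); first by exists s.
suff : K ((iota s)^-1 * iota d).
  by move=> Ksd; have := normal_subgroupM nK Ksd Kd; grp_simp.
by move=> i'' _; have := Ks i'' Logic.I; rewrite /= gmulfM multiplicativeV.
Qed.

End Fibres.

(** * Preimages and images of finite index normal subgroups *)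

Section Images.
Variables (G H : groupType) (f : {multiplicative G -> H}).
Variables (I : Type).
Implicit Types (N : set G) (M : set H).

Lemma normal_preimage M : normal_subgroup M -> normal_subgroup (f @^-1` M).
Proof.
move=> nM; split; last by move=> g h Mh; rewrite /= !gmulfM multiplicativeV; exact: normal_conj.
split; first by apply/mem_set; rewrite /= multiplicative1; exact: normal_subgroup1.
move=> g h /set_mem Mg /set_mem Mh; apply/mem_set.
by rewrite /= gmulfM multiplicativeV; exact: normal_subgroupF.
Qed.

Lemma normal_image N : range f = setT -> normal_subgroup N -> normal_subgroup (f @` N).
Proof.
move=> fT nN; split; last first.
  move=> g _ [h Nh <-]; have [x _ <-] : range f g by rewrite fT.
  exists (x * h * x^-1); first exact: normal_conj.
  by rewrite !gmulfM multiplicativeV.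
split; first by apply/mem_set; exists 1; [exact: normal_subgroup1|exact: multiplicative1].
move=> _ _ /set_mem[g Ng <-] /set_mem[h Nh <-]; apply/mem_set.
by exists (g / h); [exact: normal_subgroupF|rewrite gmulfM multiplicativeV].
Qed.

Lemma finite_index_preimage M :
  normal_subgroup M -> finite_index M -> finite_index (f @^-1` M).
Proof.
move=> nM fM; apply: sub_finite_set (finite_image (fun C => f @^-1` C) fM).
move=> _ [g _ <-]; exists (lcoset M (f g)); first by exists (f g).
have nfM := normal_preimage nM.
by apply/seteqP; split=> x /lcosetP Mx; apply/lcosetP; move: Mx;
  rewrite /= gmulfM multiplicativeV.
Qed.

Lemma finite_index_image N :
  range f = setT -> finite_index N -> finite_index (f @` N).
Proof.
move=> fT fN; apply: sub_finite_set (finite_image (fun C => f @` C) fN).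
move=> y [h _ <-]; have [g _ <-] : range f h by rewrite fT.
exists (lcoset N g); first by exists g.
apply/seteqP; split=> [_ [_ [n Nn <-] <-]|_ [_ [n Nn <-] <-]].
  by exists (f n); [exists n|rewrite gmulfM].
by exists (g * n); [exists n|rewrite gmulfM].
Qed.

Lemma directed_preimage (N : I -> set H) :
  directed_by_inclusion N -> directed_by_inclusion (fun i => f @^-1` N i).
Proof. by move=> [I0 dN]; split=> // i j; have [k Nk] := dN i j; exists k => x /Nk. Qed.

Lemma directed_image (N : I -> set G) :
  directed_by_inclusion N -> directed_by_inclusion (fun i => f @` N i).
Proof.
move=> [I0 dN]; split=> // i j; have [k Nk] := dN i j; exists k.
by move=> _ [x /Nk[Ni Nj] <-]; split; exists x.
Qed.

End Images.

(** Each element of [S] outside the intersection is missed by some [N i]; directedness gives one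
    level for all of them. *)
Lemma directed_finite_avoid (G : groupType) (I : Type) (N : I -> set G) (S : set G) :
  directed_by_inclusion N -> finite_set S ->
  exists i, forall s, S s -> N i s -> (\bigcap_i N i) s.
Proof.
move=> [[i0] dN] /finite_seqP[l ->]; elim: l => [|x l [i IH]]; first by exists i0.
have [Kx|/existsNP[i1 nNx]] := pselect (forall i, N i x).
  by exists i => s /=; rewrite inE => /orP[/eqP -> _|/IH//] j _.
have [k Nk] := dN i i1; exists k => s /=; rewrite inE => /orP[/eqP -> /Nk[]//|].
by move=> ls /Nk[Ns _]; exact: IH.
Qed.

Lemma coset_label (G : groupType) (H : set G) : normal_subgroup H -> finite_index H ->
  exists (l : G -> nat) M, (forall g, (l g < M)%N) /\
    forall g h, l g = l h <-> H (g^-1 * h).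
Proof.
move=> nH /finite_seqP[s es].
have ins g : lcoset H g \in s by change ([set` s] (lcoset H g)); rewrite -es; exists g.
exists (fun g => index (lcoset H g) s), (size s); split=> [g|g h].
  by rewrite index_mem.
rewrite -(lcoset_eqP nH); split=> [e|-> //].
by rewrite -(nth_index set0 (ins g)) e nth_index.
Qed.

(** * Separation and the cover of the extension *)

Section Extension.
Variables (Delta Gamma Lambda : groupType).
Variables
  (iota : {multiplicative Delta -> Gamma}) (pi : {multiplicative Gamma -> Lambda}).
Hypothesis exact_mid : range iota = [set g | pi g = 1].
Hypothesis pi_surj : range pi = setT.
Variables (I : Type) (N : I -> set Gamma).
Hypothesis nN : forall i, normal_subgroup (N i).
Hypothesis N_index : forall i, finite_index (N i).
Hypothesis N_directed : directed_by_inclusion N.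
Hypothesis N_sep : separates (fun i => quo (normal_bigcap nN) @` N i)
  (quo (normal_bigcap nN) @` range iota).
Let K := \bigcap_i N i.
Let nK : normal_subgroup K := normal_bigcap nN.

(** If [n] in [N i] has [pi n = pi g], then [g * n^-1] lies in the image of [Delta] and in the coset
    of [g] modulo [N i]. So no level tells [g] from [Delta], and separation puts [g] in
    [Delta K]. *)
Lemma separated_core g : (\bigcap_i (pi @` N i)) (pi g) ->
  exists d, K ((iota d)^-1 * g).
Proof.
move=> Ng; apply: contrapT => nd.
have : ~ (quo nK @` range iota) (quo nK g).
  move=> [_ [d _ <-]] /(congr1 val)/= /lcoset_eqP Kd; apply: nd; exists d; exact: Kd.
move=> /N_sep[i]; apply.
have [n Nn en] := Ng i Logic.I.
have : range iota (g * n^-1) by rewrite exact_mid /= gmulfM multiplicativeV en mulgV.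
move=> [d _ ed]; exists (quo nK (iota d)); first by exists (iota d) => //; exists d.
apply/lcoset_eqP; last first.
  exists n => //; rewrite -multiplicativeV -gmulfM ed.
  by grp_simp.
apply: normal_image => //; apply/seteqP; split=> // x _.
by have [y ->] := quo_surj x; exists y.
Qed.

(** A representative is chosen in each double coset of [Delta] and [N i], then an element of [Delta]
    carrying it to the given point modulo [N i]. *)
Lemma chart_exists i : exists ch, chart iota N i ch.
Proof.
have nNi := nN i.
pose P g := [set iota d * g * n | d in setT & n in N i].
have PE d g n : N i n -> P (iota d * g * n) = P g.
  move=> Nn; apply/seteqP; split=> _ [e _ [n' Nn' <-]].
    exists (e * d) => //; exists (n * n'); first exact: normal_subgroupM.
    by rewrite gmulfM; grp_simp.
  exists (e * d^-1) => //; exists (n^-1 * n').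
    by apply: normal_subgroupM => //; exact: normal_subgroupV.
  by rewrite gmulfM multiplicativeV; grp_simp.
pose r g := xget 1 (P g).
pose Q g := [set d | N i ((iota d * r g)^-1 * g)].
have Qg g : Q g (xget 1 (Q g)).
  case: (xgetP 1 (P g)) => [x erg [d _ [n Nn en]]|/(_ g)[]]; last first.
    by exists 1 => //; exists 1; [exact: normal_subgroup1|rewrite multiplicative1; grp_simp].
  case: xgetP => // /(_ d^-1)[]; rewrite /Q /= /r -erg -en multiplicativeV.
  by have := normal_subgroupV nNi Nn; grp_simp.
pose ch g := xget 1 (Q g).
exists ch => d g n Nn; have := Qg (iota d * g * n); have := Qg g.
rewrite -/(ch g) -/(ch (iota d * g * n)).
move: (ch g) (ch (iota d * g * n)) => e e'.
(* Both points lie in one double coset, so [PE] gives them the same representative. *)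
rewrite /Q /= {2}/r PE// -/(r g) => Ne Ne'.
have := normal_subgroupM nNi Ne (normal_subgroupV nNi
  (normal_subgroupM nNi Ne' (normal_subgroupV nNi Nn))).
move=> /(normal_conj nNi (r g)).
by rewrite !gmulfM !multiplicativeV gmulfM; grp_simp.
Qed.

Lemma multicover_extension k c c' : (k < c + c')%N ->
  multicover (fun i => iota @^-1` N i) k c ->
  multicover (fun i => pi @` N i) k c' -> multicover N k 1.
Proof.
move=> kcc mD mL F fF.
have [i0 [A [SL [fSL Ai Ac AS]]]] := mL _ (finite_image pi fF).
(* An element of the finite bound [SL] in the image of [N i1] lies in the image of every [N i]. *)
have [i1 i1P] := directed_finite_avoid (directed_image pi N_directed) fSL.
have nL i : normal_subgroup (pi @` N i) by exact: normal_image.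
have [l [M [lM lE]]] := coset_label (nL i1) (finite_index_image pi_surj (@N_index i1)).
pose lab g := l (pi g).
have lab_return j : (j < k)%N -> forall g a, A j (pi g) ->
    reach (pi @` F) (A j) (pi g) (pi a) -> lab (a * g) = lab g ->
    exists d, K ((iota d)^-1 * a).
  move=> jk g a Ag ra /lE; rewrite gmulfM.
  move=> /(normal_conj (nL i1) (pi g)); grp_simp.
  move=> /(normal_subgroupV (nL i1)); grp_simp => Na.
  have [s Ss Ks] := AS _ jk _ _ Ag ra.
  apply: separated_core => i _.
  (* Equal labels put [pi a] in the image of [N i1], and [s] agrees with [pi a] at every level. *)
  have Ns : (pi @` N i1) s.
    have := normal_subgroupM (nL i1) Na (normal_subgroupV (nL i1) (Ks i1 Logic.I)).
    by grp_simp.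
  by have := normal_subgroupM (nL i) (i1P s Ss Ns i Logic.I) (Ks i Logic.I); grp_simp.
have [i2 [E [S [fS Ei Ec ES]]]] := fibrewise_cover nN N_directed fF mD lab_return M.
have [_ dN] := N_directed.
(* [i4] lies below the levels of [A], of the labels and of [E]. *)
have [i3 Ni3] := dN i0 i1; have [i4 Ni4] := dN i2 i3.
have [ch chP] := chart_exists i4.
exists i4, (piece pi A lab E ch M), S; split=> //.
- move=> j g h N4h [_ Ag Eg]; have [N2h /Ni3[N0h N1h]] := Ni4 _ N4h.
  have labh : lab (g * h) = lab g.
    by apply/lE; rewrite gmulfM -[pi h]invgK; grp_simp; apply: normal_subgroupV => //; exists h.
  split; rewrite ?labh ?gmulfM; [exact: lM|by apply: Ai => //; exists h|].
  have /Ni4[N2 _] := chP 1 g h N4h.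
  move: N2; rewrite multiplicative1 !mul1g => N2.
  exact/(right_invariantE nN (Ei _ _) N2).
- move=> g; pose J := cover_index A k (pi g);
  pose J' := cover_index (E (lab g)) k (ch g).
  (* Inclusion-exclusion: [J] and [J'] have at least [c + c'] elements together, their union at most
     [k]. *)
  have [j] : exists j, j \in J :&: J'.
    apply/set0Pn; rewrite -card_gt0 -(ltn_add2l #|J :|: J'|) addn0 cardsUI.
    apply: leq_ltn_trans (leq_trans kcc _); first
      by have := max_card (J :|: J'); rewrite card_ord.
    by rewrite addnC; apply: leq_add; [exact: Ac|exact: (Ec _ (lM _))].
  rewrite finset.in_setI => /andP[/cover_indexP Aj /cover_indexP Ej].
  by rewrite card_gt0; apply/set0Pn; exists j; apply/cover_indexP; split=> //; exact: lM.
by move=> j jk; apply: (ES i4 ch) => // x /Ni4[].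
Qed.

End Extension.

(** * Covers of the odometer *)

Section OdometerCovers.
Variables (G : groupType) (I : Type) (N : I -> set G).
Hypothesis nN : forall i, normal_subgroup (N i).
Let K := \bigcap_i N i.
Let nK : normal_subgroup K := normal_bigcap nN.
Local Notation X := (profinite_completion N).
Implicit Types (x y : X) (a g h : G) (F S : set G).

Definition coord i x : set G := val (val x i).

Lemma coordP i x : exists g, coord i x = lcoset (N i) g.
Proof. by have /set_mem[g _ e] := valP (val x i); exists g. Qed.

Lemma coord_ext x y : (forall i, coord i x = coord i y) -> x = y.
Proof.
move=> xy; apply: val_inj; apply: functional_extensionality_dep => i.
by apply: val_inj; exact: xy.
Qed.

Lemma coord_odometer i a x g :
  coord i x = lcoset (N i) g -> coord i (odometer N a x) = lcoset (N i) (a * g).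
Proof. by rewrite /coord /= => ->; rewrite lcosetM. Qed.

(** By normality every coset of [N i] has stabiliser [N i], so every point has stabiliser [K]. *)
Lemma odometer_eq a b x : odometer N a x = odometer N b x <-> K (b^-1 * a).
Proof.
split=> [e i _|Kba].
  have [g xg] := coordP i x.
  have := congr1 (coord i) e; rewrite !(coord_odometer _ xg) => /(lcoset_eqP (nN i)).
  move=> /(normal_conj (nN i) g); grp_simp.
  by move=> /(normal_subgroupV (nN i)); grp_simp.
apply: coord_ext => i; have [g xg] := coordP i x; rewrite !(coord_odometer _ xg).
apply/esym/(lcoset_eqP (nN i)); have := normal_conjV (nN i) g (Kba i Logic.I).
by grp_simp.
Qed.

Lemma nbhs_cylinder x i : nbhs x [set y | coord i y = coord i x].
Proof.
have : nbhs x [set y | val y i = val x i].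
  exact: completion_coord_continuous (discrete_set1 _).
by apply: filterS => y e; exact: (congr1 val e).
Qed.

Lemma orbit_reach F U i x g f : coord i x = lcoset (N i) g ->
  (forall h, h \in f -> F h) ->
  (forall k, (1 <= k <= size f)%N -> coord i (act_seq (odometer N) x (take k f)) `<=` U) ->
  exists2 a, reach F U g a & act_seq (odometer N) x f = odometer N a x.
Proof.
move=> xg; elim/last_ind: f => [|f c IH] Ff Uf.
  by exists 1; [exact: reach1|rewrite odometer1].
have [h hf|k /andP[k1 kf]|a ra ea] := IH.
- by apply: Ff; rewrite mem_rcons inE hf orbT.
- have := Uf k; rewrite size_rcons k1 leqW// => /(_ isT).
  by rewrite -cats1 takel_cat.
have ec : act_seq (odometer N) x (rcons f c) = odometer N (c * a) x.
  by rewrite odometerM /= -ea /act_seq foldl_rcons.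
exists (c * a) => //; apply: reachS => //; first by apply: Ff; rewrite mem_rcons inE eqxx.
have := Uf (size (rcons f c)); rewrite take_size ec leqnn andbT size_rcons => /(_ isT).
apply; rewrite (coord_odometer _ xg); apply/lcosetP; grp_simp; exact: normal_subgroup1.
Qed.

Lemma multicover_dad d : multicover N d.+1 1 -> has_dad_cover (odometer N) d.
Proof.
move=> mc F /mc[i [U [S [fS Ui Uc US]]]].
(* Only coordinate [i] is consulted, so these sets are open; right invariance makes them a cover. *)
exists (fun j => [set x | coord i x `<=` U j]); split.
- move=> j; rewrite openE => x Ux; apply: filterS (nbhs_cylinder x i) => y /= ->.
  exact: Ux.
- rewrite -subTset => x _; have [g xg] := coordP i x.
  have /set0Pn[j /cover_indexP Uj] : cover_index U d.+1 g != finset.set0.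
    by rewrite -card_gt0.
  by exists j => //= h; rewrite xg => -[n Nn <-]; exact: Ui.
move=> j; have [B SB] := (finite_set_leP S).1 fS; exists B => x Ux.
apply: card_le_trans SB; apply: card_le_trans (card_image_le (fun s => odometer N s x) S).
apply: subset_card_le => _ [f [Ff -> Uf]].
have [g xg] := coordP i x.
have [a ra ->] := orbit_reach xg Ff Uf.
have Ug : U j g by apply: Ux; rewrite xg; apply/lcosetP; grp_simp; exact: normal_subgroup1.
have [s Ss Ks] := US _ (ltn_ord j) _ _ Ug ra.
by exists s => //; apply/esym/odometer_eq.
Qed.

End OdometerCovers.

(** * From bounded orbits to bounded words *)

Lemma uniq_size_card (T : eqType) (s : seq T) (P : set T) B :
  uniq s -> (forall x, x \in s -> P x) -> (P #<= `I_B)%card -> (size s <= B)%N.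
Proof.
case: s => // x0 s'; set s := x0 :: s' => us sP PB; rewrite -card_le_II.
apply: card_le_trans PB.
have nth_inj : {in `I_(size s) &, injective (nth x0 s)}.
  by move=> i j /set_mem/= si /set_mem/= sj /eqP; rewrite nth_uniq// => /eqP.
rewrite -(card_le_eql (inj_card_eq nth_inj)).
by apply: subset_card_le => _ [i /= si <-]; apply/sP/mem_nth.
Qed.

Fixpoint words (G : groupType) (F : set G) n : set G :=
  if n is n'.+1 then words F n' `|` prodset F (words F n') else [set 1].

Lemma finite_words (G : groupType) (F : set G) n : finite_set F -> finite_set (words F n).
Proof.
by move=> fF; elim: n => [|n IH] //=; rewrite finite_setU; split=> //; exact: finite_prodset.
Qed.

Lemma words_le (G : groupType) (F : set G) n m :
  (n <= m)%N -> words F n `<=` words F m.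
Proof. by move/subnK <-; elim: (m - n)%N => // k IH a /IH; left. Qed.

Section OdometerWords.
Variables (G : groupType) (I : Type) (N : I -> set G).
Hypothesis nN : forall i, normal_subgroup (N i).
Hypothesis N_index : forall i, finite_index (N i).
Hypothesis N_directed : directed_by_inclusion N.
Let K := \bigcap_i N i.
Let nK : normal_subgroup K := normal_bigcap nN.
Local Notation X := (profinite_completion N).
Implicit Types (x y : X) (a g h : G) (F S : set G).

Lemma coord_sub i j x y : N i `<=` N j -> coord i y = coord i x -> coord j y = coord j x.
Proof.
move=> Nij e; have /set_mem cx := valP x; have /set_mem cy := valP y.
have [g [xi xj]] := cx _ _ Nij; have [h [yi yj]] := cy _ _ Nij.
rewrite /coord xj yj; apply/(lcoset_eqP (nN j)); apply: Nij.
by apply/(lcoset_eqP (nN i)); rewrite -xi -yi.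
Qed.

Lemma principal_subproof g :
  (fun i => SigSub (mem_set (imageT (lcoset (N i)) g)) : lcosets (N i))
    \in [set x | compatible (N := N) x].
Proof. by apply/mem_set => i j _; exists g. Qed.

Definition principal g : X := SigSub (principal_subproof g).

Lemma coord_principal i g : coord i (principal g) = lcoset (N i) g.
Proof. by []. Qed.

Lemma odometer_principal a g : odometer N a (principal g) = principal (a * g).
Proof. by apply: coord_ext => i; rewrite (coord_odometer _ (coord_principal i g)). Qed.

(** Directedness makes the cylinders at [x] a filter base; it converges to [x] because convergence
    is coordinatewise. *)
Lemma open_cylinder (U : set X) x : open U -> U x ->
  exists i, forall y, coord i y = coord i x -> U y.
Proof.
move=> oU Ux; have [[i0] dN] := N_directed.
pose C := filter_from setT (fun i => [set y : X | coord i y = coord i x]).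
have FC : Filter C.
  apply: filter_from_filter; first by exists i0.
  move=> i j _ _; have [k Nk] := dN i j; exists k => // y e.
  by split; apply: coord_sub e => z /Nk[].
suff : C --> x by move=> /(_ U (open_nbhs_nbhs (conj oU Ux)))[i _ CU]; exists i.
move=> V [_ /= [[W oW <-]]] /= Wx WV; apply: (filterS WV).
have [_ H] := cvg_sup
  (fun i => Topological.class (initial_topology (fun f : (forall i,
    discrete_topology (lcosets (N i))) => f i)))
  (val x) (fmap_filter set_val FC).
suff : set_val @ C --> (val x : prod_topology (fun i => discrete_topology (lcosets (N i)))).
  by apply; exact: open_nbhs_nbhs.
apply: H => i T [_ /= [[V' _ <-]]] /= V'x V'T.
exists i => // y e; apply: V'T.
have ei : val y i = val x i by apply: val_inj; exact: e.
by rewrite /= set_valE /= ei.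
Qed.

(** A Lebesgue number argument: if every level failed, the sets [C i] of bad points would generate a
    proper filter, and a cluster point would have a cylinder inside some [U j] that contains a bad
    point of the same level. *)
Lemma cover_level (J : Type) (U : J -> set X) :
  (forall j, open (U j)) -> \bigcup_j U j = setT ->
  exists i, forall x : X, exists j, forall y : X, coord i y = coord i x -> U j y.
Proof.
move=> oU Uc; have [[i0] dN] := N_directed.
apply: contrapT => /forallNP noi.
pose C i := [set x : X | ~ exists j, forall y, coord i y = coord i x -> U j y].
have PF : ProperFilter (filter_from setT C).
  apply: filter_from_proper; last first.
    by move=> i _; have /existsNP[x] := noi i; exists x.
  apply: filter_from_filter; first by exists i0.
  move=> i j _ _; have [k Nk] := dN i j; exists k => // x nx.
  split=> -[l lU]; apply: nx; exists l => y e; apply: lU; apply: coord_sub e => z /Nk[] //.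
have [x [_ clx]] := profinite_completion_compact N_index PF filterT.
have [j _ Ux] : (\bigcup_j U j) x by rewrite Uc.
have [i iU] := open_cylinder (oU j) Ux.
have [y [ny ey]] := clx (C i) _ (ex_intro2 _ _ i Logic.I (@subset_refl _ _)) (nbhs_cylinder x i).
by apply: ny; exists j => z; rewrite ey; exact: iU.
Qed.

Definition orbit_step F (U : set X) : rel X :=
  fun x y => `[< exists2 f, F f & y = odometer N f x /\ U y >].

Lemma path_partial_orbit F U x p : path (orbit_step F U) x p ->
  partial_orbit (odometer N) F U x (last x p).
Proof.
elim/last_ind: p => [_|p y IH].
  by exists [::]; split=> // k; case: k.
rewrite rcons_path last_rcons => /andP[/IH[f [Ff -> Uf]] /asboolP[c Fc [-> Uc]]].
have ec : act_seq (odometer N) x (rcons f c) = odometer N c (act_seq (odometer N) x f).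
  by rewrite /act_seq foldl_rcons.
exists (rcons f c); split=> // [h|k].
  by rewrite mem_rcons inE => /orP[/eqP -> //|/Ff].
rewrite size_rcons => /andP[k1]; rewrite leq_eqVlt => /orP[/eqP ->|].
  by rewrite -(size_rcons f c) take_size ec.
rewrite ltnS => kf; rewrite -cats1 takel_cat//; apply: Uf; exact/andP.
Qed.

Lemma path_words F U x p : path (orbit_step F U) x p ->
  exists2 a, words F (size p) a & last x p = odometer N a x.
Proof.
elim/last_ind: p => [_|p y IH]; first by exists 1; rewrite ?odometer1.
rewrite rcons_path last_rcons => /andP[/IH[a wa ->] /asboolP[c Fc [-> Uc]]].
exists (c * a); last by rewrite odometerM.
by rewrite size_rcons; right; exact: prodset_mem.
Qed.

(** With its repetitions removed, the path in the odometer visits at most [B] points, so a word of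
    length at most [B] has the same endpoint and agrees with [a] modulo [K]. *)
Lemma reach_words F (V : set G) (U : set X) B g a :
    (forall h, V h -> U (principal h)) -> V g ->
    (partial_orbit (odometer N) F U (principal g) #<= `I_B)%card ->
  reach F V g a -> coset_in K (words F B) a.
Proof.
move=> VU Vg UB ra.
have [p pp ep] : exists2 p, path (orbit_step F U) (principal g) p &
    last (principal g) p = principal (a * g).
  elim: ra => [|b f _ [p pp ep] Ff Vf]; first by exists [::]; rewrite ?mul1g.
  exists (rcons p (principal (f * b * g))); last by rewrite last_rcons.
  rewrite rcons_path pp ep; apply/asboolP; exists f => //.
  by rewrite odometer_principal mulgA; split=> //; exact: VU.
rewrite -odometer_principal in ep.
case: (shortenP pp) ep => q pq uq _ eq.
have [b wb eb] := path_words pq.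
exists b; last by apply/(odometer_eq nN a b (principal g)); rewrite -eb eq.
apply: words_le wb; apply: leq_trans (uniq_size_card uq _ UB) => // x.
rewrite inE => /orP[/eqP ->|xq]; first exact: (path_partial_orbit (p := [::])).
case/splitPl: (mem_behead (s := principal g :: q) xq) pq => p1 p2 <-.
by rewrite cat_path => /andP[/path_partial_orbit].
Qed.

Lemma dad_multicover d : has_dad_cover (odometer N) d -> multicover N d.+1 1.
Proof.
move=> dad F fF; have [U [oU Uc /choice[B UB]]] := dad F fF.
have [i iU] := cover_level oU Uc.
(* [V j] keeps the cosets whose whole cylinder lies in the open set; [inord] turns the natural index
   into an ordinal. *)
pose V j : set G := [set g | forall y : X, coord i y = lcoset (N i) g -> U (inord j) y].
have VU j h : V j h -> U (inord j) (principal h) by apply.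
exists i, V, (\bigcup_(j in [set: 'I_d.+1]) words F (B j)); split.
- by apply: bigcup_finite => // j _; exact: finite_words.
- move=> j g h Nh Vg y ey; apply: Vg; rewrite ey; apply/(lcoset_eqP (nN i)); grp_simp.
  exact: normal_subgroupV.
- move=> g; have [j Uj] := iU (principal g).
  rewrite card_gt0; apply/set0Pn; exists j; apply/cover_indexP => y ey.
  by rewrite inord_val; exact: Uj.
move=> j jd g a Vg ra; apply: (coset_in_sub (S := words F (B (inord j)))).
  by move=> x wx; exists (inord j).
exact: (reach_words (@VU j) Vg (UB _ _ (VU _ _ Vg)) ra).
Qed.

End OdometerWords.

Lemma dad_free_fin (G : groupType) (X : topologicalType) (act : G -> X -> X) :
  dad_free act = +oo%E \/
  exists2 d, dad_free act = (Posz d)%:E & has_dad_cover act d.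
Proof.
rewrite /dad_free; case: pselect => [h|_]; last by left.
by right; exists (ex_minn h) => //; case: ex_minnP => d /asboolP.
Qed.

Lemma dad_free_le (G : groupType) (X : topologicalType) (act : G -> X -> X) d :
  has_dad_cover act d -> (dad_free act <= (Posz d)%:E)%E.
Proof.
move=> ad; rewrite /dad_free; case: pselect => [h|nh].
  by rewrite lee_fin; case: ex_minnP => e _ /(_ d); apply; apply/asboolP.
by exfalso; apply: nh; exists d; apply/asboolP.
Qed.

Unset Implicit Arguments.
Set Strict Implicit.
Set Printing Implicit Defensive.

Theorem theorem3 (Delta Gamma Lambda : groupType)
    (iota : {multiplicative Delta -> Gamma})
    (pi : {multiplicative Gamma -> Lambda})
    (Delta_countable : countable [set: Delta])
    (Gamma_countable : countable [set: Gamma])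
    (Lambda_countable : countable [set: Lambda])
    (iota_inj : injective iota)
    (exact_mid : range iota = [set g | pi g = 1])
    (pi_surj : range pi = setT)
    (Gamma_rf : residually_finite Gamma)
    (I : Type) (N : I -> set Gamma)
    (I_countable : countable [set: I])
    (N_normal : forall i, normal_subgroup (N i))
    (N_index : forall i, finite_index (N i))
    (N_directed : directed_by_inclusion N)
    (N_sep : separates (fun i => quo (normal_bigcap N_normal) @` N i)
                       (quo (normal_bigcap N_normal) @` range iota))
    (m n : \bar int) :
  dad_free (odometer (fun i => iota @^-1` N i)) = m ->
  dad_free (odometer (fun i => pi @` N i)) = n ->
  (dad_free (odometer N) <= m + n)%E.
Proof.
move=> <- <-.
have normal_pre i : normal_subgroup (iota @^-1` N i) by exact: normal_preimage.
have normal_im i : normal_subgroup (pi @` N i) by exact: normal_image.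
(* An infinite summand makes the bound trivial; the other value is inspected so that the sum
   computes to [+oo]. *)
case: (dad_free_fin (odometer (fun i => iota @^-1` N i))) => [->|[dD -> dadD]].
  by case: (dad_free_fin (odometer (fun i => pi @` N i))) => [->|[d -> _]]; exact: leey.
case: (dad_free_fin (odometer (fun i => pi @` N i))) => [->|[dL -> dadL]].
  exact: leey.
apply: (dad_free_le (d := (dD + dL)%N)); apply: multicover_dad => //.
have mD : multicover (fun i => iota @^-1` N i) (dD.+1 + dL) (1 + dL).
  apply: multicoverD => //; apply: dad_multicover => // [i|].
    exact: finite_index_preimage.
  exact: directed_preimage.
have mL : multicover (fun i => pi @` N i) (dL.+1 + dD) (1 + dD).
  apply: multicoverD => //; apply: dad_multicover => // [i|].
    exact: finite_index_image.
  exact: directed_image.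
have ek : (dL.+1 + dD = dD.+1 + dL)%N by rewrite !addSn addnC.
rewrite ek in mL.
(* The multiplicities add up to [dD + dL + 2], one more than the number of sets. *)
apply: (multicover_extension exact_mid pi_surj N_index N_directed N_sep _ mD mL).
by rewrite !add1n addSn addnS addSn addnC.
Qed.
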